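(* For all $z\in\mathbb N\cup\{\infty\}$, $\mathrm{TD}(\mathrm{NC}\Pi^z_{\infty,1})=\mathrm{PBTD}(\mathrm{NC}\Pi^z_{\infty,1})=0$. Suppose $m\ge2$. (i) If $z=1$, then $\mathrm{TD}(\mathrm{NC}\Pi^1_{\infty,m})=\Theta(m)$ and $\mathrm{PBTD}(\mathrm{NC}\Pi^1_{\infty,m})=\Theta(m)$ (as functions of $m$). (ii) For $n\in\mathbb N_0$ let $\omega(n)$ be the number of distinct prime factors of $n$ and let $P(n)$ be the number of prime powers (including primes) not exceeding $n$. If $z\ge2$, then $\max\{\omega(n):n\le m\}\le\mathrm{TD}(\mathrm{NC}\Pi^z_{\infty,m})\le2+P(m-1)$, and $\mathrm{PBTD}(\mathrm{NC}\Pi^z_{\infty,m})=\mathrm{PBTD}(\mathrm{NC}\Pi^z)=1$. In particular, $\max\{\omega(n):n\le m\}\le\mathrm{TD}(\mathrm{NC}\Pi^z_{\infty,m})<O\big((m-1)^{1/2}\log(m-1)\big)+\frac{1.25506(m-1)}{\log(m-1)}$.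
   Context: Fix a countably infinite set $X$ of variables and an alphabet $\Sigma$ (finite or countably infinite, disjoint from $X$), $z=|\Sigma|$. A pattern is a nonempty finite string over $X\cup\Sigma$. A substitution is a morphism $h:(X\cup\Sigma)^*\to\Sigma^*$ fixing letters; $L(\pi)$ (erasing pattern language) is the set of all $h(\pi)$; patterns with equal languages are identified. A non-cross pattern is a constant-free pattern of the form $x_0^{n_0}x_1^{n_1}\cdots x_k^{n_k}$ with distinct variables $x_i$ and $n_i\ge1$. $\mathrm{NC}\Pi^z_{\infty,m}$ is the class of non-cross patterns over an alphabet of size $z$ in which every variable occurs at most $m$ times; $\mathrm{NC}\Pi^z$ is the class of all non-cross patterns. A labelled example is $(w,\pm)$ with $w\in\Sigma^*$; a teaching set for $\pi$ w.r.t. a class $\Pi$ is a set $T$ of labelled examples consistent with $\pi$ such that every $\tau\in\Pi$ consistent with $T$ has $L(\tau)=L(\pi)$; $\mathrm{TD}(\pi,\Pi)$ is its minimum size and $\mathrm{TD}(\Pi)=\sup_{\pi\in\Pi}\mathrm{TD}(\pi,\Pi)$. For a strict partial order $\prec$ on $\Pi$, a teaching set for $\pi$ w.r.t. $(\Pi,\prec)$ is a teaching set for $\pi$ w.r.t. $\Pi\setminus\{\pi':\pi'\prec\pi\}$; $\mathrm{PBTD}(\Pi,\prec)$ is the supremum over $\pi$ of the minimum size of such sets, and $\mathrm{PBTD}(\Pi)=\inf_\prec\mathrm{PBTD}(\Pi,\prec)$. *)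

(* Defs.v *)
From Stdlib Require Import Reals.
From HB Require Import structures.
From mathcomp Require Import all_boot.

Set Implicit Arguments.
Unset Strict Implicit.
Unset Printing Implicit Defensive.

(* Alphabet size z in N ∪ {∞}: [Some k] is a finite alphabet of size k,
   [None] is a countably infinite alphabet.  The alphabet Sigma_z is
   {0,...,k-1} (resp. all of nat). *)
Definition inSigma (z : option nat) (a : nat) : bool :=
  if z is Some k then a < k else true.

Definition word := seq nat.
Definition is_word (z : option nat) (w : word) : bool := all (inSigma z) w.

(* Symbols over X ∪ Sigma: [inl x] is the variable x (X = nat),
   [inr a] is the letter a. *)
Definition symbol := (nat + nat)%type.
Definition pattern := seq symbol.

Definition is_pattern (z : option nat) (p : pattern) : bool :=
  (p != [::]) &&
  all (fun s : symbol => if s is inr a then inSigma z a else true) p.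

Definition subst (h : nat -> word) (p : pattern) : word :=
  flatten (map (fun s : symbol => match s with
                                  | inl x => h x
                                  | inr a => [:: a] end) p).

Definition substitution (z : option nat) (h : nat -> word) : Prop :=
  forall x, is_word z (h x).

Definition lang (z : option nat) (p : pattern) (w : word) : Prop :=
  exists h, substitution z h /\ w = subst h p.

Definition same_lang (z : option nat) (p q : pattern) : Prop :=
  forall w, lang z p w <-> lang z q w.

Definition noncross (p : pattern) : Prop :=
  exists (xs ns : seq nat),
    [/\ xs != [::], size ns = size xs, uniq xs, all (fun n => 0 < n) ns &
        p = flatten (map (fun xn : nat * nat => nseq xn.2 (@inl nat nat xn.1))
                         (zip xs ns))].

Definition occ_le (m : nat) (p : pattern) : Prop :=
  forall x : nat, count (fun s : symbol => s == inl x) p <= m.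

Definition NC (z : option nat) (p : pattern) : Prop :=
  is_pattern z p /\ noncross p.

Definition NCm (z : option nat) (m : nat) (p : pattern) : Prop :=
  NC z p /\ occ_le m p.

Definition example := (word * bool)%type.

Definition consistent (z : option nat) (p : pattern) (e : example) : Prop :=
  lang z p e.1 <-> e.2 = true.

(* T is a teaching set for p w.r.t. the class C (a predicate on patterns;
   patterns with equal languages are identified via same_lang).  A finite
   set of examples is represented by a list; its size bounds the cardinality. *)
Definition teaching_set (z : option nat) (C : pattern -> Prop) (p : pattern)
    (T : seq example) : Prop :=
  [/\ forall e, e \in T -> is_word z e.1,
      forall e, e \in T -> consistent z p e &
      forall q, C q -> (forall e, e \in T -> consistent z q e) -> same_lang z q p].

Definition TD_le (z : option nat) (C : pattern -> Prop) (d : nat) : Prop :=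
  forall p, C p -> exists T, size T <= d /\ teaching_set z C p T.

Definition TD_ge (z : option nat) (C : pattern -> Prop) (d : nat) : Prop :=
  exists p, C p /\ forall T, teaching_set z C p T -> d <= size T.

Definition TD_eq z C d := TD_le z C d /\ TD_ge z C d.

(* Strict partial orders on the class, i.e. on patterns up to language
   equality (the relation must be compatible with same_lang). *)
Definition strict_po (r : pattern -> pattern -> Prop) : Prop :=
  (forall p, ~ r p p) /\ (forall p q s, r p q -> r q s -> r p s).

Definition lang_compatible (z : option nat) (r : pattern -> pattern -> Prop) :=
  forall p p' q q', same_lang z p p' -> same_lang z q q' -> r p q -> r p' q'.

Definition below_removed (C : pattern -> Prop) (r : pattern -> pattern -> Prop)
    (p : pattern) : pattern -> Prop :=
  fun q => C q /\ ~ r q p.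

Definition PBTD_ord_le z C r (d : nat) : Prop :=
  forall p, C p -> exists T, size T <= d /\ teaching_set z (below_removed C r p) p T.

Definition PBTD_ord_ge z C r (d : nat) : Prop :=
  exists p, C p /\ forall T, teaching_set z (below_removed C r p) p T -> d <= size T.

Definition PBTD_le z C (d : nat) : Prop :=
  exists r, [/\ strict_po r, lang_compatible z r & PBTD_ord_le z C r d].

Definition PBTD_ge z C (d : nat) : Prop :=
  forall r, strict_po r -> lang_compatible z r -> PBTD_ord_ge z C r d.

Definition PBTD_eq z C d := PBTD_le z C d /\ PBTD_ge z C d.

(* omega(n): number of distinct prime factors (primes 0 = [::]). *)
Definition omega (n : nat) : nat := size (primes n).

(* q is a prime power p^k with p prime, k >= 1 (p, k <= q necessarily). *)
Definition prime_power (q : nat) : bool :=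
  [exists p : 'I_q.+1, exists k : 'I_q.+1,
     prime p && (0 < (k : nat)) && (q == (p : nat) ^ (k : nat))].

Definition Ppow (n : nat) : nat := count prime_power (iota 1 n).

(* Main.v *)
Require Import Defs.
From Stdlib Require Import Reals Lra Classical.
From HB Require Import structures.
From mathcomp Require Import all_boot zify.

(** A pattern [x0^n0 ... xk^nk] is represented by its exponent sequence.
    Over two letters the word [(0 1^k)^n0 (0 1^(k-1))^n1 ... 0^nk] is
    characteristic: if it is a product of powers [v_j^(m_j)] with all
    [m_j >= 2], then each [v_j] is a power of some [0 1^c], because a square
    cannot run across the blocks of decreasing [c].  Hence the [m_j] split into
    consecutive blocks, the [i]-th of which generates [n_i] additively, and the
    language of the pattern is contained in that of the other one.

    One positive characteristic word therefore suffices once larger languages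
    are preferred, so PBTD is 1.  For TD, add for each prime power [q <= m] a
    negative characteristic word made of [r + 1] equal exponents
    [lcm {n <= m : q does not divide n}], where [r] counts the exponents of the
    pattern not divisible by [q]; these force every block to be the single
    [n_i] when [m >= 3], and [q = 0] does the same job for [m = 2].  The lower
    bound uses [x^n] against the [x^(n/p)]: a word in two of these languages
    belongs to that of [x^n].

    Over one letter the languages are submonoids of the naturals generated by
    numbers up to [m]; those containing all numbers above [2k] and an arbitrary
    part of [k+1..2k] shatter [k] words.

    Asymptotically, all primes in (n, 6n] divide (6n)! / ((3n)! (2n)! n!), which
    is at most [432^n], so the logarithm of the primorial of [x] is at most
    [1.225 x + O(1)], and [1.225 / 0.98 < 1.25506]. *)

(** * Powers of words *)

Definition rep (n : nat) (v : word) : word := flatten (nseq n v).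

Lemma repS n v : rep n.+1 v = v ++ rep n v.
Proof. by []. Qed.

Lemma rep_nil n : rep n [::] = [::].
Proof. by elim: n. Qed.

Lemma repD a b v : rep (a + b) v = rep a v ++ rep b v.
Proof. by rewrite /rep nseqD flatten_cat. Qed.

Lemma repM a b v : rep (a * b) v = rep b (rep a v).
Proof.
by elim: b => [|b IH]; rewrite ?muln0 // mulnS repD IH.
Qed.

Lemma size_rep n v : size (rep n v) = n * size v.
Proof. by elim: n => // n IH; rewrite repS size_cat IH mulSn. Qed.

Lemma is_word_rep z n v : 0 < n -> is_word z (rep n v) = is_word z v.
Proof.
case: n => // n _; elim: n => [|n IH]; first by rewrite /rep /= cats0.
by rewrite repS /is_word all_cat -/(is_word z v) -/(is_word z (rep n.+1 v)) IH andbb.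
Qed.

Lemma rep_nseq n t (a : nat) : rep n (nseq t a) = nseq (n * t) a.
Proof. by elim: n => // n IH; rewrite repS IH mulSn nseqD. Qed.

Lemma nth_rep n v i : i < n * size v -> nth 0 (rep n v) i = nth 0 v (i %% size v).
Proof.
elim: n i => // n IH i; rewrite mulSn repS nth_cat => lti.
case: ltnP => [lt|ge]; first by rewrite modn_small.
rewrite IH; last by lia.
by rewrite -{2}(subnK ge) modnDr.
Qed.

(** * Languages of non-cross patterns in terms of exponent sequences *)

Fixpoint power_lang (ns : seq nat) (w : word) : Prop :=
  if ns is n :: ns' then exists v w', w = rep n v ++ w' /\ power_lang ns' w'
  else w = [::].

Lemma power_lang_nil ns : power_lang ns [::].
Proof. by elim: ns => // n ns IH; exists [::], [::]; rewrite rep_nil. Qed.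

Lemma power_lang_cat ns ms w w' :
  power_lang ns w -> power_lang ms w' -> power_lang (ns ++ ms) (w ++ w').
Proof.
elim: ns w => [w -> //|n ns IH w [v [w1 [-> H]]] H'].
by exists v, (w1 ++ w'); rewrite catA; split=> //; apply: IH.
Qed.

Lemma power_lang_full ns w : 1 \in ns -> power_lang ns w.
Proof.
elim: ns => // n ns IH; rewrite inE => /orP[/eqP<-|H].
  by exists w, [::]; rewrite /rep /= !cats0; split=> //; apply: power_lang_nil.
by exists [::], w; rewrite rep_nil; split=> //; apply: IH.
Qed.

Lemma power_lang_letter ns a : power_lang ns [:: a] -> 1 \in ns.
Proof.
elim: ns => // n ns IH [v [w' [E H]]]; rewrite inE.
have := congr1 size E; rewrite size_cat size_rep /= => E1.
case: v E E1 => [|x v] E E1.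
  by rewrite rep_nil /= in E; rewrite IH ?orbT // E.
case: n E E1 => [|[|n]] // E E1; last by move: E1 => /=; lia.
by rewrite /= in E; rewrite IH ?orbT // E.
Qed.

Definition noncross_pattern (xs ns : seq nat) : pattern :=
  flatten (map (fun xn : nat * nat => nseq xn.2 (@inl nat nat xn.1)) (zip xs ns)).

Lemma subst_cat h p q : subst h (p ++ q) = subst h p ++ subst h q.
Proof. by rewrite /subst map_cat flatten_cat. Qed.

Lemma subst_nseq h n x : subst h (nseq n (inl x)) = rep n (h x).
Proof. by rewrite /subst map_nseq. Qed.

Lemma subst_noncross_pattern_ext h h' xs ns :
  {in xs, h =1 h'} -> subst h (noncross_pattern xs ns) = subst h' (noncross_pattern xs ns).
Proof.
elim: xs ns => [|x xs IH] [|n ns] // E; rewrite /noncross_pattern /= !subst_cat !subst_nseq.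
rewrite E ?mem_head // -/(noncross_pattern xs ns) IH // => y yx.
by apply: E; rewrite inE yx orbT.
Qed.

(** Distinct variables can be substituted independently, so only the exponents matter. Positive
    exponents let the alphabet condition pass between a power and its base. *)
Lemma lang_noncross_pattern z xs ns : uniq xs -> size ns = size xs -> all (fun n => 0 < n) ns ->
  forall w, lang z (noncross_pattern xs ns) w <-> is_word z w /\ power_lang ns w.
Proof.
move=> U S P w; split.
  case=> h [Hh ->] {w}; elim: xs ns S P {U} => [|x xs IH] [|n ns] //= [S] /andP[n0 P].
  rewrite /noncross_pattern /= subst_cat subst_nseq -/(noncross_pattern xs ns).
  have [W L] := IH _ S P; split; last by exists (h x), (subst h (noncross_pattern xs ns)).
  rewrite /is_word all_cat -/(is_word z (rep n (h x))) is_word_rep // Hh.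
  exact: W.
case; elim: xs ns w U S P => [|x xs IH] [|n ns] w //=.
  by move=> _ _ _ _ ->; exists (fun=> [::]).
move=> /andP[xx U] [S] /andP[n0 P] + [v [w' [E H]]].
rewrite {}E /is_word all_cat -/(is_word z (rep n v)) is_word_rep // => /andP[Wv Ww].
have [h [Hh Ew]] := IH _ _ U S P Ww H.
exists (fun y => if y == x then v else h y); split.
  by move=> y; case: ifP.
rewrite /noncross_pattern /= subst_cat subst_nseq eqxx Ew; congr (_ ++ _).
apply: subst_noncross_pattern_ext => y yx; case: eqP => // Eyx.
by rewrite -Eyx yx in xx.
Qed.

Lemma count_noncross_pattern xs ns x : x \notin xs ->
  count (fun s : symbol => s == inl x) (noncross_pattern xs ns) = 0.
Proof.
elim: xs ns => [|y xs IH] [|n ns] //; rewrite inE negb_or => /andP[nxy nx].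
rewrite /noncross_pattern /= count_cat -/(noncross_pattern xs ns) IH // count_nseq.
by rewrite (inj_eq inl_inj) eq_sym (negbTE nxy).
Qed.

Lemma occ_noncross_pattern m xs ns : uniq xs -> size ns = size xs ->
  occ_le m (noncross_pattern xs ns) <-> all (fun n => n <= m) ns.
Proof.
elim: xs ns => [|x xs IH] [|n ns] //= U [S].
case: (andP U) => nx U'; have {}IH := IH _ U' S.
have cE y : count (fun s : symbol => s == inl y) (noncross_pattern (x :: xs) (n :: ns)) =
    (x == y) * n + count (fun s : symbol => s == inl y) (noncross_pattern xs ns).
  by rewrite /noncross_pattern /= count_cat count_nseq (inj_eq inl_inj).
split=> [O|/andP[nm /IH O] y]; last first.
  rewrite cE; case: eqP => [<-|_]; last by rewrite mul0n; apply: O.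
  by rewrite count_noncross_pattern // addn0 mul1n.
apply/andP; split.
  by have := O x; rewrite cE eqxx mul1n; lia.
by apply/IH => y; have := O y; rewrite cE; apply: leq_trans; apply: leq_addl.
Qed.

Definition expo (m : nat) (ns : seq nat) : bool :=
  (ns != [::]) && all (fun n => 0 < n <= m) ns.

Definition realizes z p ns := forall w, lang z p w <-> is_word z w /\ power_lang ns w.

Lemma NCmP z m p : NCm z m p -> exists2 ns, expo m ns & realizes z p ns.
Proof.
case=> [[_ [xs [ns [x0 S U P ->]]]]]; rewrite -/(noncross_pattern xs ns).
move=> /occ_noncross_pattern-/(_ U S) O.
exists ns; last exact: lang_noncross_pattern.
rewrite /expo -size_eq0 S size_eq0 x0 /=.
by apply/allP => n nn; rewrite (allP P) // (allP O).
Qed.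

(** Reduces the unbounded class to the bounded ones, with a bound depending on the pattern. *)
Lemma NCP z p : NC z p -> exists m, NCm z m p.
Proof.
move=> H; exists (size p); split=> // x; exact: count_size.
Qed.

Definition canonical_pattern (ns : seq nat) : pattern := noncross_pattern (iota 0 (size ns)) ns.

Lemma NCm_canonical_pattern z m ns : expo m ns ->
  NCm z m (canonical_pattern ns) /\ realizes z (canonical_pattern ns) ns.
Proof.
case/andP=> n0 /allP A.
have U : uniq (iota 0 (size ns)) by apply: iota_uniq.
have S : size ns = size (iota 0 (size ns)) by rewrite size_iota.
have P : all (fun n => 0 < n) ns by apply/allP => n /A /andP[].
split; last exact: lang_noncross_pattern.
split; last by apply/occ_noncross_pattern => //; apply/allP => n /A /andP[].
split; last first.
  by exists (iota 0 (size ns)), ns; split=> //; case: (ns) n0.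
apply/andP; split.
  by case: ns n0 P {A U S} => // -[|n] ns.
apply/allP => s /flattenP[t /mapP[[x n] _ ->]].
by rewrite mem_nseq => /andP[_ /eqP->].
Qed.

Lemma realizes_same z p q ns : realizes z p ns -> realizes z q ns -> same_lang z p q.
Proof. by move=> Hp Hq w; rewrite Hp Hq. Qed.

(** * Additive generation and coverings of exponent sequences *)

Fixpoint gen (B : seq nat) (n : nat) : Prop :=
  if B is b :: B' then exists t n', n = t * b + n' /\ gen B' n' else n = 0.

(** The combinatorial side of language containment: [covers_power_lang] gives containment from a
    covering, and [code_covers] recovers the covering from one word. *)
Fixpoint covers (ns ms : seq nat) : Prop :=
  if ns is n :: ns' then exists B ms', [/\ ms = B ++ ms', gen B n & covers ns' ms']
  else ms = [::].

Lemma gen_power_lang B n v : gen B n -> power_lang B (rep n v).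
Proof.
elim: B n => [n -> //|b B IH n [t [n' [-> H]]]].
exists (rep t v), (rep n' v); rewrite repD repM; split=> //; exact: IH.
Qed.

Lemma covers_power_lang ns ms w : covers ns ms -> power_lang ns w -> power_lang ms w.
Proof.
elim: ns ms w => [ms w -> //|n ns IH ms w [B [ms' [-> G C]]] [v [w' [-> H]]]].
by apply: power_lang_cat; [apply: gen_power_lang | apply: IH].
Qed.

Lemma gen_dvd d B n : gen B n -> all (dvdn d) B -> d %| n.
Proof.
elim: B n => [n -> //|b B IH n [t [n' [-> H]]] /= /andP[db A]].
by rewrite dvdn_add ?dvdn_mull // IH.
Qed.

Lemma gen0 B : gen B 0.
Proof. by elim: B => // b B IH; exists 0, 0. Qed.

Lemma gen_dvd_mem B b n : b \in B -> b %| n -> gen B n.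
Proof.
elim: B => // c B IH; rewrite inE => /orP[/eqP<- d|bB d].
  by exists (n %/ b), 0; rewrite divnK // addn0; split=> //; apply: gen0.
by exists 0, n; split=> //; apply: IH.
Qed.

(** * Block codes and characteristic words *)

Definition code (s : seq nat) : word := flatten [seq 0 :: nseq c 1 | c <- s].
Arguments code : simpl never.

Lemma code_cons c s : code (c :: s) = 0 :: nseq c 1 ++ code s.
Proof. by []. Qed.

Lemma code_cat s t : code (s ++ t) = code s ++ code t.
Proof. by rewrite /code map_cat flatten_cat. Qed.

Lemma code_word z s : inSigma z 0 -> inSigma z 1 -> is_word z (code s).
Proof.
move=> z0 z1; elim: s => // c s IH; rewrite code_cons /is_word /= z0 all_cat.
by rewrite all_nseq z1 orbT.
Qed.

(** The letter 0 occurs only at the start of a block, so a cut in front of a 0 falls between two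
    blocks. *)
Lemma code_parse s x y : code s = x ++ 0 :: y ->
  exists s1 s2, [/\ s = s1 ++ s2, x = code s1 & 0 :: y = code s2].
Proof.
elim: s x y => [|c s IH] x y; first by case: x.
case: x => [|x0 x] E; first by exists [::], (c :: s).
move: E; rewrite code_cons /= => -[<-].
elim: c x => [|c IHc] x /=.
  by move=> /IH[s1 [s2 [-> -> ->]]]; exists (0 :: s1), s2.
case: x => [|x1 x] //= [<-] /IHc[s1 [s2 [E1 E2 E3]]].
case: s1 E1 E2 => [|c1 s1] //= [<- ->] [->].
by exists (c.+1 :: s1), s2.
Qed.

Lemma code_head a s x : 0 :: nseq a 1 ++ x = code s ->
  exists c s', [/\ s = c :: s', a <= c & x = nseq (c - a) 1 ++ code s'].
Proof.
case: s => // c s [E]; exists c, s; move: E.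
elim: a c => [|a IH] c /=; first by rewrite subn0.
case: c => [|c] /=; first by case: (s).
by case=> /IH[_ ? ->].
Qed.

(** A block with [a] ones cannot fit into a block of [s], so the prefix is confined to the leading
    run. *)
Lemma code_nseq_prefix j r a s w : all (fun c => c < a) s ->
  code (nseq j a) ++ w = code (nseq r a ++ s) ->
  j <= r /\ w = code (nseq (r - j) a ++ s).
Proof.
move=> A; elim: j r => [|j IH] r; first by rewrite subn0.
rewrite -[nseq j.+1 a]/(a :: nseq j a) code_cons cat_cons -catA => E.
have [c [s' [Es ac Ew]]] := code_head _ _ _ E.
case: r E Es => [|r] E /= Es.
  by move: A; rewrite Es /= ltnNge ac.
case: Es Ew => <- <-; rewrite subnn /= => /IH[? ?]; by rewrite subSS.
Qed.

Lemma code_nseq_rep n t a : rep n (code (nseq t a)) = code (nseq (n * t) a).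
Proof. by elim: n => // n IH; rewrite repS IH mulSn nseqD code_cat. Qed.

Lemma split_nseq (a r : nat) s s1 s2 : all (fun c => c < a) s ->
  nseq r a ++ s = s1 ++ a :: s2 -> s1 = nseq (size s1) a.
Proof.
elim: r s1 => [|r IH] [|c s1] // A.
  by move=> /= E; move: A; rewrite E /= all_cat /= ltnn /= !andbF.
by move=> /= [<- /IH <-].
Qed.

(* A square starting a word [(0 1^a)^r (0 1^c1) (0 1^c2) ..], all [ci < a],
   never leaves the leading block: its first half is followed by [0], hence is
   a concatenation of complete factors [0 1^c], and its second half starts
   with [0 1^a]. *)
Lemma code_power r a s m (v w : word) : all (fun c => c < a) s -> 1 < m -> v != [::] -> 0 < r ->
  rep m v ++ w = code (nseq r a ++ s) ->
  exists t, [/\ v = code (nseq t a), m * t <= r & w = code (nseq (r - m * t) a ++ s)].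
Proof.
move=> A; case: m => [|[|m]] // _ v0 r0 E.
have [v1 Ev] : exists v1, v = 0 :: v1.
  case: v v0 E => // x v _; case: r r0 => // r _.
  by rewrite repS /= => -[-> _]; exists v.
have := E; rewrite !repS {2}Ev -!catA /= => /esym/code_parse[s1 [s2 [Es Ev1 Es2]]].
have [c1 [s1' Es1]] : exists c1 s1', s1 = c1 :: s1'.
  by case: s1 Es Ev1 => [|c1 s1'] Es; [rewrite Ev | exists c1, s1'].
have Ec1 : c1 = a.
  by case: r r0 Es {E} => // r _; rewrite Es1 => -[<-].
have [c [s3 [Es2' ac]]] : exists c s3, s2 = c :: s3 /\ a <= c.
  move: Es2; rewrite -cat_cons -Ev Ev1 Es1 Ec1 code_cons /= -catA => /code_head.
  by case=> c [s3 [-> ac _]]; exists c, s3.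
(* No block has more than [a] ones, and [c] is one of the blocks. *)
have Ec : c = a.
  have : c \in nseq r a ++ s by rewrite Es Es2' mem_cat mem_head orbT.
  rewrite mem_cat mem_nseq => /orP[/andP[_ /eqP]//|/(allP A)]; lia.
have Es1n : s1 = nseq (size s1) a.
  by apply: (@split_nseq a r s s1 s3 A); rewrite Es Es2' Ec.
move: (size s1) Es1n => t Es1n; exists t.
move: E; rewrite Ev1 Es1n code_nseq_rep => /(code_nseq_prefix _ _ _ _ _ A)[le_t Ew].
by split.
Qed.

Fixpoint enc (ns : seq nat) : seq nat :=
  if ns is n :: ns' then nseq n (size ns') ++ enc ns' else [::].

(** Labels count down, so whatever follows the current run satisfies the hypothesis of
    [code_power]. *)
Lemma enc_lt ns : all (fun c => c < size ns) (enc ns).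
Proof.
elim: ns => // n ns IH /=; rewrite all_cat all_nseq ltnSn orbT /=.
by apply: sub_all IH => c /ltnW.
Qed.

Lemma power_lang_code_enc ns : power_lang ns (code (enc ns)).
Proof.
elim: ns => // n ns IH /=; rewrite code_cat.
exists (code (nseq 1 (size ns))), (code (enc ns)); split=> //.
by rewrite code_nseq_rep muln1.
Qed.

(** Induction on the number of exponents left on both sides, generalised to a current run with [r]
    copies left. [B] collects the exponents of [ms] that consume this run. *)
Lemma code_covers_aux ns ms r :
  all (fun n => 0 < n) ns -> all (fun m => 1 < m) ms ->
  power_lang ms (code (nseq r (size ns) ++ enc ns)) ->
  exists B ms', [/\ ms = B ++ ms', gen B r & covers ns ms'].
Proof.
have [N] := ubnP (size ns + size ms); elim: N ns ms r => // N IH ns ms r.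
case: ms => [|m ms] le Pn Pm /=.
  by case: r => //; case: ns le Pn => [|[|n] ns] // _ _ _; exists [::], [::].
case: (andP Pm) => m1 Pm' [v [w [E H]]].
have [Ev|v0] := eqVneq v [::].
  (* An empty base lets [m] join the current block with coefficient 0. *)
  rewrite Ev rep_nil /= in E; rewrite -E in H.
  have [|B [ms' [-> G C]]] := IH ns ms r _ Pn Pm' H; first by rewrite /= in le; lia.
  by exists (m :: B), ms'; split=> //; exists 0, r.
(* When the run is used up, its block closes and the next exponent of [ns] opens the next run. *)
case: r E => [|r] E.
  case: ns le Pn E => [|n ns] le Pn E.
    by case: m m1 E {Pm le} => // m _; case: (v) v0.
  case/andP: Pn => n0 Pn.
  have [||B [ms' [E' G C]]] := IH ns (m :: ms) n _ Pn Pm.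
  - by rewrite /= in le *; lia.
  - by exists v, w.
  by exists [::], (m :: ms); split=> //; exists B, ms'.
(* The base consists of [t] blocks of the run, which shortens by [m * t]; thus [m] gets coefficient
   [t]. *)
have [t [Ev le_t Ew]] := code_power _ _ _ _ _ _ (enc_lt ns) m1 v0 (ltn0Sn r) (esym E).
rewrite Ew in H.
have [|B [ms' [-> G C]]] := IH ns ms _ _ Pn Pm' H; first by rewrite /= in le; lia.
exists (m :: B), ms'; split=> //; exists t, (r.+1 - m * t); split=> //.
by rewrite mulnC subnKC.
Qed.

Lemma code_covers ns ms : ns != [::] ->
  all (fun n => 0 < n) ns -> all (fun m => 1 < m) ms ->
  power_lang ms (code (enc ns)) -> covers ns ms.
Proof.
(* With the first run as current run, the conclusion of [code_covers_aux] is [covers] unfolded. *)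
by case: ns => // n ns _ /andP[_ Pn] Pm /(code_covers_aux _ _ _ Pn Pm).
Qed.

(** * Teaching over at least two letters *)

Definition ndvd (d n : nat) : bool := ~~ (d %| n).

(** A sum of multiples of [d] is a multiple of [d]. The boolean on the left counts as 0 or 1. *)
Lemma gen_ndvd d B n : gen B n -> ndvd d n <= count (ndvd d) B.
Proof.
move=> G; case: (boolP (ndvd d n)) => // nd; rewrite -has_count.
apply: contraNT nd => /hasPn H; apply: gen_dvd G _.
by apply/allP => b /H; rewrite negbK.
Qed.

Lemma covers_count d ns ms : covers ns ms -> count (ndvd d) ns <= count (ndvd d) ms.
Proof.
elim: ns ms => // n ns IH ms [B [ms' [-> G C]]] /=.
by rewrite count_cat leq_add ?IH ?gen_ndvd.
Qed.

(** An entry dividing [c] generates [c] alone and closes a block; other entries are absorbed with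
    coefficient 0, and the last block takes all that remains. *)
Lemma covers_nseq c k ms : k < count (dvdn^~ c) ms -> covers (nseq k.+1 c) ms.
Proof.
elim: ms k => // b ms IH k /=; case: (boolP (b %| c)) => [bc|nbc] lt_k.
  case: k lt_k => [|k] lt_k.
    exists (b :: ms), [::]; rewrite cats0; split=> //.
    by apply: (@gen_dvd_mem _ b); rewrite ?mem_head.
  exists [:: b], ms; split=> //; last by apply: IH.
  by apply: (@gen_dvd_mem _ b); rewrite ?mem_head.
have [B [ms' [-> G C]]] := IH k lt_k.
by exists (b :: B), ms'; split=> //; exists 0, c.
Qed.

(** For [d = 0] this is the least common multiple of all numbers from 1 to [m]. *)
Definition lcmnd (m d : nat) : nat := foldr lcmn 1 [seq n <- iota 1 m | ndvd d n].

Lemma dvdn_lcmnd m d n : 0 < n <= m -> ndvd d n -> n %| lcmnd m d.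
Proof.
move=> nm nd; have : n \in [seq n <- iota 1 m | ndvd d n].
  by rewrite mem_filter nd mem_iota; lia.
rewrite /lcmnd; elim: [seq _ <- _ | _] => //= a s IH; rewrite inE => /orP[/eqP<-|/IH].
  exact: dvdn_lcml.
by move/dvdn_trans; apply; apply: dvdn_lcmr.
Qed.

(** Primality with respect to least common multiples; it ensures that [d] does not divide
    [lcmnd m d]. *)
Definition lcm_prime (d : nat) : Prop :=
  ndvd d 1 /\ forall a b, 0 < a -> 0 < b -> ndvd d a -> ndvd d b -> ndvd d (lcmn a b).

Lemma lcm_prime0 : lcm_prime 0.
Proof. by split=> // a b a0 b0 _ _; rewrite /ndvd dvd0n -lt0n lcmn_gt0 a0. Qed.

Lemma prime_powerP q :
  reflect (exists p e, [/\ prime p, 0 < e & q = p ^ e]) (prime_power q).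
Proof.
apply: (iffP idP) => [/existsP[p /existsP[e /andP[/andP[pp e0] /eqP E]]]|].
  by exists p, e.
case=> p [e [pp e0 E]].
have ltp : p < q.+1 by rewrite E ltnS -{1}(expn1 p) leq_exp2l // prime_gt1.
have lte : e < q.+1 by rewrite E ltnS ltnW // ltn_expl // prime_gt1.
apply/existsP; exists (Ordinal ltp); apply/existsP; exists (Ordinal lte).
by rewrite /= pp e0 E eqxx.
Qed.

Lemma lcm_prime_power q : prime_power q -> lcm_prime q.
Proof.
case/prime_powerP=> p [e [pp e0 ->]]; split.
  by rewrite /ndvd pfactor_dvdn // logn1 -ltnNge.
move=> a b a0 b0; rewrite /ndvd !pfactor_dvdn ?lcmn_gt0 ?a0 // -!ltnNge => la lb.
by rewrite logn_lcm // gtn_max la.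
Qed.

Lemma ndvd_lcmnd m d : lcm_prime d -> ndvd d (lcmnd m d) /\ 0 < lcmnd m d.
Proof.
case=> d1 dl; rewrite /lcmnd.
have : all (fun n => (0 < n) && ndvd d n) [seq n <- iota 1 m | ndvd d n].
  by apply/allP => n; rewrite mem_filter mem_iota => /andP[-> /andP[->]].
elim: [seq _ <- _ | _] => //= a s IH /andP[/andP[a0 da] /IH[ds s0]].
by rewrite lcmn_gt0 a0 s0; split=> //; apply: dl.
Qed.

Lemma dvdn_prime_powers n b : 0 < n ->
  (forall q, prime_power q -> q %| n -> q %| b) -> n %| b.
Proof.
move=> n0 H; apply/dvdn_partP => // p pn.
have pp : prime p by move: pn; rewrite mem_primes; case/and3P.
rewrite p_part; apply: H; last by rewrite pfactor_dvdnn.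
by apply/prime_powerP; exists p, (logn p n); rewrite logn_gt0.
Qed.

Definition rigid (m : nat) (D : seq nat) : Prop :=
  forall B n, all (fun b => 1 < b <= m) B -> 1 < n <= m -> gen B n ->
    (forall d, d \in D -> count (ndvd d) B <= ndvd d n) -> B = [:: n].

(** Each block has at least as many non-multiples of [d] as the exponent it generates. As the totals
    leave no surplus, no block has one, and rigidity applies blockwise. *)
Lemma covers_rigid m D ns ms : rigid m D ->
  all (fun b => 1 < b <= m) ns -> all (fun b => 1 < b <= m) ms -> covers ns ms ->
  (forall d, d \in D -> count (ndvd d) ms <= count (ndvd d) ns) -> ms = ns.
Proof.
move=> R; elim: ns ms => [|n ns IH] ms //= /andP[nm An] Am [B [ms' [E G C]]] H.
move: Am; rewrite E all_cat => /andP[AB Am].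
have H' d : d \in D -> count (ndvd d) B <= ndvd d n /\ count (ndvd d) ms' <= count (ndvd d) ns.
  move=> /H; rewrite E count_cat.
  by have := covers_count d _ _ C; have := gen_ndvd d _ _ G; lia.
rewrite (IH ms') // => [|d /H'[]//].
by rewrite (R B n) // => d /H'[].
Qed.

(** The only prime power up to 2 is 2, which does not tell [[:: 2; 2]] from [[:: 2]]. With [d = 0]
    every entry counts, so the count is the length. *)
Lemma rigid2 : rigid 2 [:: 0].
Proof.
move=> B n AB n2 G /(_ 0 (mem_head _ _)).
have -> : n = 2 by lia.
have E : all (pred1 2) B by apply: sub_all AB => b /= ?; apply/eqP; lia.
have -> : count (ndvd 0) B = size B.
  apply/eqP; rewrite -all_count; apply: sub_all E => b /eqP-> //.
case: B G E {AB} => [|b [|b' B]] //=; first by lia.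
by move=> _ /andP[/eqP->].
Qed.

Lemma gen_le B n : 0 < n -> gen B n -> exists2 b, b \in B & b <= n.
Proof.
elim: B n => [|b B IH] n n0 /=; first by move=> E; rewrite E in n0.
case=> [[|t] [n' [E G]]].
  have {}E : n = n' by lia.
  by rewrite -E in G; have [c cB le_c] := IH n n0 G; exists c; rewrite ?inE ?cB ?orbT.
by exists b; rewrite ?mem_head // E; lia.
Qed.

(* Every element of [B] is a multiple of [n], and every element besides one
   copy of [n] is a multiple of all prime powers up to [m], hence exceeds [m]. *)
Lemma rigid_prime_powers m : 2 < m -> rigid m [seq q <- iota 1 m | prime_power q].
Proof.
move=> m2 B n AB nm G H.
have {}H q : prime_power q -> q <= m -> count (ndvd q) B <= ndvd q n.
  move=> qq qm; apply: H; rewrite mem_filter qq mem_iota.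
  suff : 0 < q by lia.
  by case/prime_powerP: qq => p [e [pp _ ->]]; rewrite expn_gt0 prime_gt0.
have dvB b : b \in B -> n %| b.
  move=> bB; apply: dvdn_prime_powers => [|q qq qn]; first by lia.
  have qm : q <= m by have := dvdn_leq _ qn; lia.
  have := H q qq qm; rewrite {2}/ndvd qn leqn0; apply: contraTT => nqb.
  by rewrite -lt0n -has_count; apply/hasP; exists b.
have nB : n \in B.
  have [|b bB le_b] := gen_le _ _ _ G; first by lia.
  suff -> : n = b by [].
  by have := dvdn_leq _ (dvB b bB); have := allP AB _ bB; lia.
have := perm_to_rem nB; case: (rem n B) => [|b B'] PB; first exact: perm_small_eq PB.
have bB : b \in B by rewrite (perm_mem PB) !inE eqxx orbT.
have dvb x : 0 < x <= m -> x %| b.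
  move=> xm; apply: dvdn_prime_powers => [|q qq qx]; first by lia.
  have qm : q <= m by have := dvdn_leq _ qx; lia.
  have := H q qq qm; rewrite (permP PB) /= -{2}[nat_of_bool _]addn0 leq_add2l.
  by rewrite leqn0 addn_eq0 eqb0 negbK => /andP[].
(* The coprime numbers [m] and [m.-1] both divide [b], and their product exceeds [m] because
   [m > 2]. *)
have := allP AB _ bB; have : m * m.-1 %| b.
  rewrite Gauss_dvd; first by rewrite !dvb //; lia.
  by rewrite coprimenP; lia.
by move/dvdn_leq; nia.
Qed.

Definition negative_word m d ns : word := code (enc (nseq (count (ndvd d) ns).+1 (lcmnd m d))).

(** Membership would give a covering, hence one more non-multiple of [d] in [ns] than there are. *)
Lemma negative_word_notin m d ns : lcm_prime d -> all (fun n => 1 < n) ns ->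
  ~ power_lang ns (negative_word m d ns).
Proof.
move=> /(ndvd_lcmnd m)[ndl l0] A P.
have /(covers_count d) : covers (nseq (count (ndvd d) ns).+1 (lcmnd m d)) ns.
  by apply: code_covers P => //; rewrite all_nseq l0 orbT.
by rewrite count_nseq ndl mul1n ltnn.
Qed.

Lemma sub_in_count (T : eqType) (a b : pred T) s :
  {in s, subpred a b} -> count a s <= count b s.
Proof.
elim: s => //= x s IH H; apply: leq_add.
  by case: (a x) (H x (mem_head _ _)) => // ->.
by apply: IH => y ys; apply: H; rewrite inE ys orbT.
Qed.

(** Every non-multiple of [d] up to [m] divides [lcmnd m d], so [ms] has enough divisors for
    [covers_nseq]. *)
Lemma negative_word_in m d ns ms : expo m ms ->
  count (ndvd d) ns < count (ndvd d) ms -> power_lang ms (negative_word m d ns).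
Proof.
case/andP=> _ /allP A lt; apply: covers_power_lang (power_lang_code_enc _); apply: covers_nseq.
apply: leq_trans lt _; apply: sub_in_count => b bm.
exact/dvdn_lcmnd/A.
Qed.

Lemma expo_gt1 m ns : expo m ns -> 1 \notin ns -> all (fun n => 1 < n <= m) ns.
Proof.
case/andP=> _ /allP A n1; apply/allP => n nn; have := A n nn.
by case: n nn => [|[|n]] // nn; rewrite nn in n1.
Qed.

Definition two_letters z := inSigma z 0 && inSigma z 1.

Lemma teach_rigid z m D ns p : two_letters z -> rigid m D -> D != [::] ->
  (forall d, d \in D -> lcm_prime d) ->
  expo m ns -> 1 \notin ns -> realizes z p ns ->
  teaching_set z (NCm z m) p
    ((code (enc ns), true) :: [seq (negative_word m d ns, false) | d <- D]).
Proof.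
case/andP=> z0 z1 R D0 HD En n1 Rp; have An := expo_gt1 _ _ En n1.
have An1 : all (fun n => 1 < n) ns by apply: sub_all An => n /andP[].
have W s : is_word z (code s) by apply: code_word.
split=> [e|e|q /NCmP[ms Em Rq] H].
- by rewrite inE => /orP[/eqP->|/mapP[d _ ->]]; apply: W.
- rewrite inE => /orP[/eqP->|/mapP[d /HD dD ->]]; rewrite /consistent Rp /=.
    by split=> // _; split; [apply: W | apply: power_lang_code_enc].
  by split=> // -[_ /negative_word_notin]; case.
have Hpos : power_lang ms (code (enc ns)).
  by have := H _ (mem_head _ _); rewrite /consistent Rq /= => -[_ []].
have Hneg d : d \in D -> ~ power_lang ms (negative_word m d ns).
  move=> dD P; have := H (negative_word m d ns, false); rewrite inE map_f // orbT.
  by move=> /(_ isT) [+ _]; rewrite Rq /= => /(_ (conj (W _) P)).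
(* An exponent 1 makes the language full, so any negative example excludes it; [D] is nonempty to
   supply one. *)
have m1 : 1 \notin ms.
  apply/negP => m1; case: D D0 Hneg {R HD H} => // d D _ /(_ d (mem_head _ _)).
  by apply; apply: power_lang_full.
have Am := expo_gt1 _ _ Em m1.
suff E : ms = ns by apply: (realizes_same z q p ns) => //; rewrite -E.
apply: (covers_rigid _ _ _ _ R) => // [|d dD].
  apply: code_covers Hpos; first by case/andP: En.
    by apply: sub_all An1 => n /ltnW.
  by apply: sub_all Am => n /andP[].
by rewrite leqNgt; apply/negP => /(negative_word_in _ _ _ _ Em); apply: Hneg.
Qed.

Lemma teach_full z m ns p : two_letters z -> 1 \in ns -> realizes z p ns ->
  teaching_set z (NCm z m) p [:: ([:: 0], true)].
Proof.
case/andP=> z0 z1 n1 Rp; split=> [e|e|q /NCmP[ms Em Rq] H].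
- by rewrite inE => /eqP->; rewrite /is_word /= z0.
- rewrite inE => /eqP->; rewrite /consistent Rp /= z0.
  by split=> // _; split=> //; apply: power_lang_full.
have m1 : 1 \in ms.
  apply: (@power_lang_letter _ 0).
  by have := H _ (mem_head _ _); rewrite /consistent Rq /= => -[_ []].
by move=> w; rewrite Rp Rq; split=> -[W _]; split=> //; apply: power_lang_full.
Qed.

(** Fits the positive example and one negative example per prime power up to [m] into the bound
    [2 + Ppow (m - 1)]. *)
Lemma Ppow_pred m : Ppow m <= (Ppow (m - 1)).+1.
Proof.
case: m => // m; rewrite subn1 /Ppow -{1}(addn1 m) iotaD count_cat /= addn0.
by case: (prime_power _); lia.
Qed.

Lemma TD_upper z m : two_letters z -> 1 < m -> TD_le z (NCm z m) (2 + Ppow (m - 1)).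
Proof.
move=> z2 m1 p /NCmP[ns En Rp]; case: (boolP (1 \in ns)) => n1.
  by exists [:: ([:: 0], true)]; split; [|apply: teach_full n1 Rp].
case: m m1 En => [|[|[|m]]] // _ En.
  exists ((code (enc ns), true) :: [seq (negative_word 2 d ns, false) | d <- [:: 0]]).
  split=> //; apply: teach_rigid => //; first exact: rigid2.
  by move=> d; rewrite inE => /eqP->; apply: lcm_prime0.
set D := [seq q <- iota 1 m.+3 | prime_power q].
have sD : size D = Ppow m.+3 by rewrite size_filter.
exists ((code (enc ns), true) :: [seq (negative_word m.+3 d ns, false) | d <- D]).
split; first by rewrite /= size_map sD; apply: Ppow_pred.
apply: teach_rigid => //; first exact: rigid_prime_powers.
  have : 2 \in D by rewrite mem_filter mem_iota /= andbT; apply/prime_powerP; exists 2, 1.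
  by case: (D).
by move=> d; rewrite mem_filter => /andP[/lcm_prime_power].
Qed.

(** * Preference-based teaching with one positive example *)

Definition char_word (ns : seq nat) : word :=
  if 1 \in ns then [:: 0] else code (enc ns).

Lemma power_lang_char_word ns : power_lang ns (char_word ns).
Proof. by rewrite /char_word; case: ifP => [/power_lang_full|_] //; apply: power_lang_code_enc. Qed.

Lemma char_word_sub m m' ns ms : expo m ns -> expo m' ms -> power_lang ms (char_word ns) ->
  forall w, power_lang ns w -> power_lang ms w.
Proof.
move=> En Em P w; case: (boolP (1 \in ms)) => [/power_lang_full // | m1].
case: (boolP (1 \in ns)) P => n1; rewrite /char_word ?n1 ?(negbTE n1).
  by move/power_lang_letter; rewrite (negbTE m1).
move=> P; apply: covers_power_lang; apply: code_covers P; first by case/andP: En.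
  by apply: sub_all (expo_gt1 _ _ En n1) => n; lia.
by apply: sub_all (expo_gt1 _ _ Em m1) => n; lia.
Qed.

Definition larger_lang z (q p : pattern) : Prop :=
  (forall w, lang z p w -> lang z q w) /\ ~ (forall w, lang z q w -> lang z p w).

(** A competitor consistent with the characteristic word has at least the language of [p]. Strictly
    larger languages come first in the order and are removed, so equality remains. *)
Lemma PBTD_upper z (C : pattern -> Prop) : two_letters z ->
  (forall p, C p -> NC z p) -> PBTD_le z C 1.
Proof.
move=> z2 CN; exists (larger_lang z); split.
- split=> [p [] //|p q s [pq nqp] [qs nsq]]; split; first by auto.
  by move=> H; apply: nqp; auto.
- move=> p p' q q' Ep Eq [qp npq]; split.
    by move=> w /Eq/qp/Ep.
  by move=> H; apply: npq => w /Ep/H/Eq.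
move=> p /CN/NCP[m /NCmP[ns En Rp]].
have W : is_word z (char_word ns).
  case/andP: z2 => z0 z1; rewrite /char_word; case: ifP => _.
    by rewrite /is_word /= z0.
  exact: code_word.
exists [:: (char_word ns, true)]; split=> //; split=> [e|e|q [/CN/NCP[m' /NCmP[ms Em Rq]] nr] H].
- by rewrite inE => /eqP->.
- rewrite inE => /eqP->; rewrite /consistent Rp /=.
  by split=> // _; split=> //; apply: power_lang_char_word.
have P : power_lang ms (char_word ns).
  by have := H _ (mem_head _ _); rewrite /consistent Rq /= => -[_ []].
have pq w : lang z p w -> lang z q w.
  by rewrite Rp Rq => -[? ?]; split=> //; apply: char_word_sub P _ _; eauto.
move=> w; split; last exact: pq.
have : ~ ~ (forall w, lang z q w -> lang z p w) by move=> ?; apply: nr.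
by move/NNPP; apply.
Qed.

(** * Lower bounds and the unary alphabet *)

Lemma teaching_set_sub z (C C' : pattern -> Prop) p T :
  (forall q, C' q -> C q) -> teaching_set z C p T -> teaching_set z C' p T.
Proof. by move=> sub [W Co H]; split=> // q /sub; apply: H. Qed.

(** Under the empty order no competitor is removed, so preference-based teaching is ordinary
    teaching. *)
Definition no_order (p q : pattern) : Prop := False.

Lemma no_order_po : strict_po no_order.
Proof. by split=> [p []|p q s []]. Qed.

Lemma TD_PBTD_le z C d : TD_le z C d -> PBTD_le z C d.
Proof.
move=> H; exists no_order; split; [exact: no_order_po | by [] |].
move=> p /H[T [sT HT]]; exists T; split=> //.
by apply: teaching_set_sub HT => q [].
Qed.

Lemma PBTD_TD_ge z C d : PBTD_ge z C d -> TD_ge z C d.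
Proof.
move=> /(_ no_order) [|//|p [Cp H]]; first exact: no_order_po.
exists p; split=> // T HT.
by apply: H; apply: teaching_set_sub HT => q [].
Qed.

Lemma exists_minimal (T : eqType) (r : T -> T -> Prop) (l : seq T) :
  (forall p, ~ r p p) -> (forall p q s, r p q -> r q s -> r p s) -> l != [::] ->
  exists2 p, p \in l & forall q, q \in l -> ~ r q p.
Proof.
move=> irr tr; elim: l => // p l IH _; case: (eqVneq l [::]) => [->|/IH[p0 p0l Hp0]].
  by exists p; rewrite ?mem_head // => q; rewrite inE => /eqP->.
case: (classic (r p p0)) => [rp|nrp].
  exists p; rewrite ?mem_head // => q; rewrite inE => /orP[/eqP->//|ql rq].
  by apply: (Hp0 q ql); apply: tr rp.
exists p0; first by rewrite inE p0l orbT.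
by move=> q; rewrite inE => /orP[/eqP->|/Hp0].
Qed.

(* The order's minimal member of the family still has the whole family to be
   taught against. *)
Lemma PBTD_ge_family z (C : pattern -> Prop) (l : seq pattern) d : l != [::] ->
  (forall p, p \in l -> C p) ->
  (forall p, p \in l -> forall T, teaching_set z (fun q => q \in l) p T -> d <= size T) ->
  PBTD_ge z C d.
Proof.
move=> l0 lC H r [irr tr] _; have [p pl Hp] := exists_minimal _ r l irr tr l0.
exists p; split; first exact: lC.
by move=> T HT; apply: (H p pl); apply: teaching_set_sub HT => q ql; split; auto.
Qed.

Lemma PBTD_lower z (C : pattern -> Prop) p q : C p -> C q -> ~ same_lang z p q -> PBTD_ge z C 1.
Proof.
move=> Cp Cq npq; apply: (@PBTD_ge_family _ _ [:: p; q]) => // s.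
  by rewrite !inE => /orP[]/eqP->.
rewrite !inE => Hs [|//] [_ _ H]; case: npq.
have Hsl t : t \in [:: p; q] -> same_lang z t s by move=> tl; apply: H.
have Hp := Hsl p (mem_head _ _).
have Hq : same_lang z q s by apply: Hsl; rewrite !inE eqxx orbT.
by move=> w; rewrite (Hp w) (Hq w).
Qed.

Lemma expo_seq1 m n : 0 < n <= m -> expo m [:: n].
Proof. by rewrite /expo /= andbT. Qed.

Lemma power_lang_seq1 n w : power_lang [:: n] w <-> exists v, w = rep n v.
Proof.
split=> [[v [_ [-> ->]]]|[v ->]]; exists v; first by rewrite cats0.
by exists [::]; rewrite cats0.
Qed.

Lemma PBTD_lower_NC z m (C : pattern -> Prop) : inSigma z 0 -> 1 < m ->
  (forall p, NCm z m p -> C p) -> PBTD_ge z C 1.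
Proof.
move=> z0 m1 sub.
have [N1 R1] := NCm_canonical_pattern z m _ (expo_seq1 m 1 (ltnW m1)).
have [N2 R2] := NCm_canonical_pattern z m _ (expo_seq1 m 2 m1).
apply: (@PBTD_lower _ _ (canonical_pattern [:: 1]) (canonical_pattern [:: 2])); try exact: sub.
move=> /(_ [:: 0]) [+ _]; rewrite R1 R2 => -[].
  by split; [rewrite /is_word /= z0 | apply: power_lang_full].
by move=> _ /power_lang_letter.
Qed.

Lemma TD_one z : TD_eq z (NCm z 1) 0 /\ PBTD_eq z (NCm z 1) 0.
Proof.
have E : expo 1 [:: 1] by [].
have [N1 R1] := NCm_canonical_pattern z 1 _ E.
have full p : NCm z 1 p -> forall w, lang z p w <-> is_word z w.
  case/NCmP=> ns /andP[n0 A] Rp w; rewrite Rp; split=> [[]//|W]; split=> //.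
  apply: power_lang_full; case: ns n0 A {Rp} => // n ns _ /andP[n1 _].
  by rewrite inE (_ : n = 1) //; lia.
have le : TD_le z (NCm z 1) 0.
  move=> p Np; exists [::]; split=> //; split=> // q Nq _ w.
  by rewrite (full p Np) (full q Nq).
split; split=> //; first by exists (canonical_pattern [:: 1]).
  exact: TD_PBTD_le.
by move=> r _ _; exists (canonical_pattern [:: 1]).
Qed.

(** * Unary words as lengths, languages as submonoids of the naturals *)

Lemma power_lang_gen ns w : power_lang ns w -> gen ns (size w).
Proof.
elim: ns w => [w -> //|n ns IH w [v [w' [-> H]]]].
by exists (size v), (size w'); rewrite size_cat size_rep mulnC; split=> //; apply: IH.
Qed.

Lemma is_word1 w : is_word (Some 1) w <-> w = nseq (size w) 0.
Proof.
elim: w => [|a w IH] //; rewrite /is_word /=; split.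
  by case/andP; case: a => // _ /IH <-.
by case=> -> /IH.
Qed.

Lemma realizes1 p ns : realizes (Some 1) p ns ->
  forall w, lang (Some 1) p w <-> is_word (Some 1) w /\ gen ns (size w).
Proof.
move=> Rp w; rewrite Rp; split=> -[W H]; split=> //; first exact: power_lang_gen.
have -> : w = rep (size w) [:: 0].
  by rewrite (rep_nseq _ 1) muln1; apply/is_word1.
exact: gen_power_lang.
Qed.

Lemma gen_add ns a b : gen ns a -> gen ns b -> gen ns (a + b).
Proof.
elim: ns a b => [a b -> -> //|n ns IH a b [t [a' [-> Ga]]] [s [b' [-> Gb]]]].
by exists (t + s), (a' + b'); split; [lia | apply: IH].
Qed.

Lemma gen_mul ns t a : gen ns a -> gen ns (t * a).
Proof.
by move=> G; elim: t => [|t IH]; [apply: gen0 | rewrite mulSn; apply: gen_add].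
Qed.

Lemma gen_sub ns ms l : (forall n, n \in ns -> gen ms n) -> gen ns l -> gen ms l.
Proof.
elim: ns l => [l _ ->|n ns IH l H [t [l' [-> G]]]]; first exact: gen0.
apply: gen_add; first by apply: gen_mul; apply: H; rewrite mem_head.
by apply: IH G => k kn; apply: H; rewrite inE kn orbT.
Qed.

Lemma label_ex z p (ws : seq word) : exists T : seq example,
  map fst T = ws /\ forall e, e \in T -> consistent z p e.
Proof.
elim: ws => [|w ws [T [ET HT]]]; first by exists [::].
have [b Hb] : exists b, consistent z p (w, b).
  by case: (classic (lang z p w)) => H; [exists true | exists false].
exists ((w, b) :: T); split; first by rewrite /= ET.
by move=> e; rewrite inE => /orP[/eqP->|/HT].
Qed.

(** Labelling the lengths 1 to [m] suffices: all generators are among them, so each submonoid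
    contains the generators of the other. *)
Lemma TD_unary_le m : TD_le (Some 1) (NCm (Some 1) m) m.
Proof.
move=> p /NCmP[ns /andP[_ /allP An] /realizes1 Rp].
have [T [ET HT]] := label_ex (Some 1) p [seq nseq l 0 | l <- iota 1 m].
have W l : is_word (Some 1) (nseq l 0) by rewrite /is_word all_nseq orbT.
exists T; split; first by rewrite -(size_map fst) ET size_map size_iota.
split=> // [e eT|q /NCmP[ms /andP[_ /allP Am] /realizes1 Rq] H].
  by have := map_f fst eT; rewrite ET => /mapP[l _ ->].
have agree l : 0 < l <= m -> gen ns l <-> gen ms l.
  move=> lm; have : nseq l 0 \in map fst T.
    by rewrite ET; apply: map_f; rewrite mem_iota; lia.
  case/mapP=> e eT El; have := HT e eT; have := H e eT.
  rewrite /consistent -El Rp Rq size_nseq; have := W l; tauto.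
move=> w; rewrite Rp Rq; split=> -[Ww G]; split=> //; apply: gen_sub G => n nn.
  by apply/agree; [exact: Am | apply: (@gen_dvd_mem _ n)].
by apply/agree; [exact: An | apply: (@gen_dvd_mem _ n)].
Qed.

(** The second part, [2k+1] to [4k+1], generates every number above [2k]. Sums of two elements are
    at least [2k+2], so [X] alone decides membership between [k+1] and [2k]. *)
Definition window k (X : {set 'I_k}) : seq nat :=
  [seq k.+1 + val i | i <- enum X] ++ iota (2 * k).+1 (2 * k).+1.

Lemma gen_small k ns l : all (fun n => k < n) ns -> gen ns l -> l <= (2 * k).+1 ->
  l = 0 \/ l \in ns.
Proof.
elim: ns l => [l _ -> _|n ns IH l /= /andP[kn A] [t [l' [-> G]]] le_l]; first by left.
have [E|l'n] := IH l' A G (leq_trans (leq_addl _ _) le_l).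
  rewrite E addn0 inE in le_l *; case: t le_l => [|[|t]] le_l; first by left.
    by right; rewrite mul1n eqxx.
  by nia.
have kl := allP A _ l'n.
case: t le_l => [|t] le_l; last by nia.
by right; rewrite inE l'n orbT.
Qed.

Lemma gen_window k (X : {set 'I_k}) l :
  gen (window k X) l <-> [\/ l = 0, exists2 i, i \in X & l = k.+1 + val i | 2 * k < l].
Proof.
have memw n : n \in window k X <->
    (exists2 i, i \in X & n = k.+1 + val i) \/ 2 * k < n <= (4 * k).+1.
  rewrite mem_cat mem_iota; split=> [/orP[/mapP[i + ->]|lt]|[[i iS ->]|lt]].
  - by rewrite mem_enum; left; exists i.
  - by right; lia.
  - by apply/orP; left; apply/mapP; exists i; rewrite ?mem_enum.
  by apply/orP; right; lia.
split=> [G|].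
  have A : all (fun n => k < n) (window k X).
    by apply/allP => n /memw[[i _ ->]|]; lia.
  case: (leqP l (2 * k)) => lk; last by constructor 3.
  have [->|/memw[H|]] := gen_small _ _ _ A G (leqW lk); first by constructor 1.
    by constructor 2.
  by lia.
case=> [->|H|]; first exact: gen0.
  by apply: (@gen_dvd_mem _ l) => //; apply/memw; left.
have [N] := ubnP l; elim: N l => // N IH l ltN lk.
case: (leqP l (4 * k).+1) => le_l.
  by apply: (@gen_dvd_mem _ l) => //; apply/memw; right; lia.
(* Beyond [4k+1], subtracting [2k+1] stays above [2k]. *)
have -> : l = (2 * k).+1 + (l - (2 * k).+1) by lia.
apply: gen_add; last by apply: IH; lia.
by apply: (@gen_dvd_mem _ (2 * k).+1) => //; apply/memw; right; lia.
Qed.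

Lemma expo_window m k (X : {set 'I_k}) : (4 * k).+1 <= m -> expo m (window k X).
Proof.
move=> km; apply/andP; split.
  by rewrite -size_eq0 size_cat size_iota addnS.
apply/allP => n; rewrite mem_cat mem_iota => /orP[/mapP[i _ ->]|]; last by lia.
by have := ltn_ord i; rewrite /=; lia.
Qed.

Lemma PBTD_unary_ge m k : (4 * k).+1 <= m -> PBTD_ge (Some 1) (NCm (Some 1) m) k.
Proof.
move=> km; have pw X := NCm_canonical_pattern (Some 1) m _ (expo_window m k X km).
apply: (@PBTD_ge_family _ _ [seq canonical_pattern (window k X) | X <- enum {set 'I_k}]).
- apply/eqP => E; have : canonical_pattern (window k set0) \in [::].
    by rewrite -E; apply: map_f; rewrite mem_enum.
  by [].
- by move=> p /mapP[X _ ->]; case: (pw X).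
move=> p /mapP[X _ ->] T [W Co H].
have Rw R := realizes1 _ _ (proj2 (pw R)).
rewrite -[k]card_ord -(size_map fst T) cardE -(size_map (fun i : 'I_k => nseq (k.+1 + val i) 0)).
apply: uniq_leq_size.
  rewrite map_inj_uniq ?enum_uniq // => i j /(congr1 size).
  by rewrite !size_nseq => /addnI/val_inj.
move=> w /mapP[i _ ->]; apply/negPn/negP => nT.
(* Flipping the membership of [i] changes the language only at the word of length [k+1+i], which a
   teaching set must therefore contain. *)
pose R := if i \in X then X :\ i else i |: X.
have RS j : j != i -> (j \in R) = (j \in X).
  by rewrite /R => ji; case: ifP => _; rewrite !inE ?ji // (negbTE ji).
have Ri : (i \in R) = (i \notin X) by rewrite /R; case: ifP; rewrite !inE eqxx.
have agree l : l != k.+1 + val i -> gen (window k R) l <-> gen (window k X) l.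
  move=> li; rewrite !gen_window.
  split=> -[->|[j jX E]|lt]; try (by constructor 1); try (by constructor 3); constructor 2;
    exists j => //; move: jX; rewrite RS //; apply: contraNneq li => <-; exact/eqP.
have : same_lang (Some 1) (canonical_pattern (window k R)) (canonical_pattern (window k X)).
  apply: H; first by apply: map_f; rewrite mem_enum.
  move=> e eT; have := Co e eT; rewrite /consistent !Rw => <-.
  have We := proj1 (is_word1 _) (W e eT).
  have /agree E : size e.1 != k.+1 + val i.
    by apply: contraNneq nT => <-; rewrite -We map_f.
  by rewrite E.
move=> /(_ (nseq (k.+1 + val i) 0)); rewrite !Rw size_nseq !gen_window.
have Ww : is_word (Some 1) (nseq (k.+1 + val i) 0) by rewrite /is_word all_nseq orbT.
have ltk := ltn_ord i.
have char (Y : {set 'I_k}) : [\/ k.+1 + val i = 0, exists2 j, j \in Y & k.+1 + val i = k.+1 + val j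
    | 2 * k < k.+1 + val i] -> i \in Y.
  case=> [//|[j jX /addnI/val_inj->] //|]; rewrite /=; lia.
case=> H1 H2; case: (boolP (i \in X)) => iS.
  have [|_ /char] := H2; last by rewrite Ri iS.
  by split=> //; constructor 2; exists i.
have [|_ /char] := H1; last by rewrite (negbTE iS).
by split=> //; constructor 2; exists i => //; rewrite Ri.
Qed.

(** * Lower bound by the number of prime factors *)

Lemma injective_rel_size (S T : eqType) (r : S -> T -> Prop) s t : uniq s ->
  (forall x, x \in s -> exists2 y, y \in t & r x y) ->
  (forall x x' y, x \in s -> x' \in s -> r x y -> r x' y -> x = x') -> size s <= size t.
Proof.
elim: s t => // x s IH t /= /andP[xs us] H inj.
have [y yt rxy] := H x (mem_head _ _).
have lt : size [seq y' <- t | y' != y] < size t.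
  by rewrite size_filter -(count_predC (predC1 y)) -addn1 leq_add2l -has_count;
    apply/hasP; exists y; rewrite //= eqxx.
apply: leq_ltn_trans lt; apply: IH => // [x' x's|x1 x2 y' H1 H2].
  have [y' y't rxy'] : exists2 y, y \in t & r x' y by apply: H; rewrite inE x's orbT.
  exists y' => //; rewrite mem_filter y't andbT; apply: contraNneq xs => E.
  rewrite (inj x x' y) ?mem_head ?inE ?x's ?orbT //; by rewrite -E.
by apply: inj; rewrite inE ?H1 ?H2 orbT.
Qed.

Lemma nth_rep_mod n v i : 0 < size v -> 0 < n ->
  nth 0 (rep n v) (i %% size (rep n v)) = nth 0 v (i %% size v).
Proof.
move=> v0 n0; rewrite size_rep nth_rep; last by rewrite ltn_mod muln_gt0 n0.
by rewrite modn_dvdm // dvdn_mull.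
Qed.

(* Read cyclically, [w] has the periods [p * g] and [q * g], hence [g]. *)
Lemma rep_common n p q w : 0 < n -> prime p -> prime q -> p != q -> p %| n -> q %| n ->
  power_lang [:: n %/ p] w -> power_lang [:: n %/ q] w -> power_lang [:: n] w.
Proof.
move=> n0 pp pq npq pn qn /power_lang_seq1[u Eu] /power_lang_seq1[v Ev]; apply/power_lang_seq1.
have a0 : 0 < n %/ p by rewrite divn_gt0 ?prime_gt0 // dvdn_leq.
have b0 : 0 < n %/ q by rewrite divn_gt0 ?prime_gt0 // dvdn_leq.
have Ep : n %/ p * p = n by rewrite divnK.
have Eq : n %/ q * q = n by rewrite divnK.
move: (n %/ p) (n %/ q) a0 b0 Ep Eq Eu Ev => a b a0 b0 Ep Eq Eu Ev.
have S1 : size w = a * size u by rewrite Eu size_rep.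
have S2 : size w = b * size v by rewrite Ev size_rep.
have Euv : size u * q = size v * p.
  apply/eqP; rewrite -(eqn_pmul2l n0) -{1}Ep -Eq; apply/eqP.
  transitivity (size w * (p * q)); first by rewrite S1; lia.
  by rewrite S2; lia.
have [g Eg] : exists g, size u = g * p.
  apply/dvdnP; have : p %| size u * q by rewrite Euv dvdn_mull.
  by rewrite Gauss_dvdl // prime_coprime // dvdn_prime2.
have Ew : size w = n * g by rewrite S1 Eg -Ep; lia.
have Evg : size v = g * q.
  apply/eqP; rewrite -(eqn_pmul2r (prime_gt0 pp)) -Euv Eg; apply/eqP; lia.
have [g0|g0] := posnP g.
  by exists [::]; rewrite rep_nil; apply/size0nil; rewrite Ew g0 muln0.
(* The cyclic reading of [w], whose length is [n * g]. *)
pose f i := nth 0 w (i %% size w).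
have fp i : f (i + g * p) = f i.
  by rewrite /f Eu !nth_rep_mod // ?Eg ?muln_gt0 ?g0 ?prime_gt0 // modnDr.
have fq i : f (i + g * q) = f i.
  by rewrite /f Ev !nth_rep_mod // ?Evg ?muln_gt0 ?g0 ?prime_gt0 // modnDr.
have fpk k i : f (i + k * (g * p)) = f i.
  by elim: k => [|k IH]; rewrite ?addn0 // mulSn addnCA addnC fp.
have fqk k i : f (i + k * (g * q)) = f i.
  by elim: k => [|k IH]; rewrite ?addn0 // mulSn addnCA addnC fq.
have fg i : f (i + g) = f i.
  have /(coprimeP _ (prime_gt0 pp))[[x y] /= E] : coprime p q.
    by rewrite prime_coprime // dvdn_prime2.
  have {}E : x * p = y * q + 1 by lia.
  (* By Bezout, a shift by [g] followed by [y] periods [g * q] is a shift by [x] periods [g * p]. *)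
  rewrite -(fqk y (i + g)) -(fpk x i); congr f.
  have -> : x * (g * p) = x * p * g by rewrite mulnCA mulnC.
  by rewrite E; lia.
have fgk k i : f (i + k * g) = f i.
  by elim: k => [|k IH]; rewrite ?addn0 // mulSn addnCA addnC fg.
exists (take g w); have St : size (take g w) = g.
  by rewrite size_take Ew; case: ltnP => //; have := leq_pmull g n0; lia.
apply: (@eq_from_nth _ 0); first by rewrite size_rep St Ew.
move=> i lti; rewrite nth_rep St -?Ew // nth_take ?ltn_mod //.
have Ef j : j < size w -> nth 0 w j = f j by move=> ltj; rewrite /f modn_small.
have := ltn_pmod i g0; rewrite !Ef //; last by rewrite (leq_trans (ltn_pmod i g0)) // Ew leq_pmull.
by rewrite {2}(divn_eq i g) addnC fgk.
Qed.

(** For each prime [p] dividing [n], separating [x^(n/p)] from [x^n] takes an example in the first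
    language but not in the second. By [rep_common] no example serves two primes. Such examples are
    only known to exist, hence a relation instead of an injection. *)
Lemma TD_lower_omega z m n : inSigma z 0 -> 0 < n <= m -> TD_ge z (NCm z m) (omega n).
Proof.
move=> z0 nm; have [Nn Rn] := NCm_canonical_pattern z m _ (expo_seq1 m n nm).
exists (canonical_pattern [:: n]); split=> // T [W Co H].
pose r p (e : example) := power_lang [:: n %/ p] e.1 /\ ~ power_lang [:: n] e.1.
apply: (injective_rel_size _ _ r); first exact: primes_uniq.
  move=> p; rewrite mem_primes => /and3P[pp n0 pn].
  apply: NNPP => nex.
  have Np0 : 0 < n %/ p by rewrite divn_gt0 ?prime_gt0 // dvdn_leq.
  have npn : n %/ p < n by rewrite ltn_Pdiv ?prime_gt1.
  have [|Np Rp] := NCm_canonical_pattern z m [:: n %/ p]; first by apply: expo_seq1; lia.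
  have : same_lang z (canonical_pattern [:: n %/ p]) (canonical_pattern [:: n]).
    apply: H => // e eT; have := Co e eT; rewrite /consistent Rn Rp => <-.
    split=> -[We P]; split=> //.
      by apply: NNPP => nP; apply: nex; exists e.
    case/power_lang_seq1: P => v ->; apply/power_lang_seq1; exists (rep p v).
    by rewrite -repM mulnC divnK.
  move=> /(_ (nseq (n %/ p) 0)) [+ _]; rewrite Rn Rp => -[].
    split; first by rewrite /is_word all_nseq z0 orbT.
    by apply/power_lang_seq1; exists [:: 0]; rewrite (rep_nseq _ 1) muln1.
  move=> _ /power_lang_seq1[v /(congr1 size)]; rewrite size_nseq size_rep.
  move: (n %/ p) Np0 npn => a a0 an; case: (size v) => [|k]; rewrite ?muln0 ?mulnS; lia.
move=> p q e; rewrite !mem_primes => /and3P[pp n0 pn] /and3P[pq _ qn] [P1 nP] [P2 _].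
apply/eqP/negPn/negP => npq; apply: nP.
exact: (rep_common n p q).
Qed.

Lemma TD_lower z m : inSigma z 0 -> 1 < m -> TD_ge z (NCm z m) (\max_(n < m.+1) omega n).
Proof.
move=> z0 m1; have [i ->] : exists i : 'I_m.+1, \max_(n < m.+1) omega n = omega i.
  have [|i ->] := eq_bigmax (fun n : 'I_m.+1 => omega n); first by rewrite card_ord.
  by exists i.
have lei : i <= m by rewrite -ltnS.
(* If the maximum is attained at 0 it is [omega 0 = 0], and any pattern will do. *)
have [i0|i0] := posnP i; last by apply: TD_lower_omega; rewrite ?i0.
have [Nn _] := NCm_canonical_pattern z m _ (expo_seq1 m 1 (ltnW m1)).
by exists (canonical_pattern [:: 1]); split=> // T _; rewrite i0.
Qed.

(** * A Chebyshev bound for prime powers *)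

Lemma expnDn_term a b n i : i <= n -> 'C(n, i) * (a ^ (n - i) * b ^ i) <= (a + b) ^ n.
Proof.
by move=> le_i; rewrite expnDn (bigD1 (Ordinal (le_i : i < n.+1))) //= leq_addr.
Qed.

Definition trinom n := 'C(6 * n, 3 * n) * 'C(3 * n, n).

(** Here [432 = 64 * 27 / 4]: the first binomial is a term of [(1+1)^(6n)], and the second times
    [4^n] is a term of [(2+1)^(3n)]. *)
Lemma trinom_le n : trinom n <= 432 ^ n.
Proof.
have le1 : 'C(6 * n, 3 * n) <= 64 ^ n.
  have : 3 * n <= 6 * n by lia.
  by move/(expnDn_term 1 1); rewrite !exp1n !muln1 addn1 -(expnM 2 6).
have le2 : 'C(3 * n, n) * 4 ^ n <= 27 ^ n.
  have : n <= 3 * n by lia.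
  move/(expnDn_term 2 1); rewrite exp1n muln1 addn1 (_ : 3 * n - n = 2 * n); last by lia.
  by rewrite (expnM 2 2) (expnM 3 3).
rewrite -(@leq_pmul2r (4 ^ n)) ?expn_gt0 // -mulnA.
apply: leq_trans (leq_mul le1 le2) _.
by rewrite -!expnMn.
Qed.

(** Legendre's formula with a common range of summation, so that several factorials can be compared
    term by term. *)
Lemma logn_fact_ext p n N : prime p -> n <= N -> logn p n`! = \sum_(1 <= k < N.+1) n %/ p ^ k.
Proof.
move=> pp nN; rewrite logn_fact // [RHS](@big_cat_nat _ _ _ n.+1) //= ?ltnS //.
rewrite [X in _ = _ + X]big1_seq ?addn0 // => k /andP[_]; rewrite mem_index_iota => /andP[nk _].
by rewrite divn_small // (leq_trans nk) // ltnW // ltn_expl // prime_gt1.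
Qed.

Lemma trinom_fact n : trinom n * ((3 * n)`! * ((2 * n)`! * n`!)) = (6 * n)`!.
Proof.
have /bin_fact E1 : 3 * n <= 6 * n by lia.
have /bin_fact E2 : n <= 3 * n by lia.
rewrite -E1 (_ : 6 * n - 3 * n = 3 * n); last by lia.
rewrite -{3}E2 (_ : 3 * n - n = 2 * n); last by lia.
by rewrite /trinom; lia.
Qed.

Lemma leq_divnD3 a b c d : 0 < d -> a %/ d + (b %/ d + c %/ d) <= (a + (b + c)) %/ d.
Proof.
move=> d0; rewrite leq_divRL // !mulnDl.
by rewrite !leq_add ?leq_divM.
Qed.

(** In Legendre's formula, superadditivity of floors makes the terms of exponent at least 2
    contribute nonnegatively; the term of exponent 1 contributes at least 1. *)
Lemma prime_dvd_trinom n p : prime p -> n < p <= 6 * n -> p %| trinom n.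
Proof.
move=> pp np.
have t0 : 0 < trinom n by rewrite /trinom muln_gt0 !bin_gt0; lia.
rewrite -(expn1 p) pfactor_dvdn //.
have := congr1 (logn p) (trinom_fact n); move: (trinom n) t0 => t t0.
rewrite !lognM ?muln_gt0 ?fact_gt0 //.
rewrite (@logn_fact_ext p (3 * n) (6 * n)) ?(@logn_fact_ext p (2 * n) (6 * n))
   ?(@logn_fact_ext p n (6 * n)) ?(@logn_fact_ext p (6 * n) (6 * n)) //; try lia.
rewrite -!big_split /=.
have n0 : 0 < 6 * n by lia.
rewrite !(@big_ltn _ _ _ 1) //; try lia.
have le : \sum_(2 <= i < (6 * n).+1) (3 * n %/ p ^ i + (2 * n %/ p ^ i + n %/ p ^ i))
    <= \sum_(2 <= i < (6 * n).+1) 6 * n %/ p ^ i.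
  apply: leq_sum => i _; apply: leq_trans (leq_divnD3 _ _ _ _ _) _.
    by rewrite expn_gt0 prime_gt0.
  by rewrite (_ : 3 * n + (2 * n + n) = 6 * n) //; lia.
(* With [a < 3] and [b < 2] the first two quotients, [6n/p] is at least 1, [2a] and [3b]; in each of
   the six cases one of these exceeds [a + b]. *)
have lt : 3 * n %/ p + (2 * n %/ p + n %/ p) < 6 * n %/ p.
  have p0 := prime_gt0 pp; rewrite (divn_small (_ : n < p)); last by lia.
  rewrite addn0 leq_divRL //.
  have l1 := leq_divM (3 * n) p; have l2 := leq_divM (2 * n) p.
  have lt2 : 2 * n %/ p < 2 by rewrite ltn_divLR //; lia.
  have lt3 : 3 * n %/ p < 3 by rewrite ltn_divLR //; lia.
  move: (3 * n %/ p) (2 * n %/ p) lt2 lt3 l1 l2 => a b.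
  by case: a => [|[|[|a]]]; case: b => [|[|b]]; lia.
by rewrite expn1; lia.
Qed.

Definition primes_upto n := [seq p <- iota 1 n | prime p].
Definition primorial n := \prod_(p <- primes_upto n) p.

Lemma prod_primes_dvd l N : uniq l -> all prime l -> all (dvdn^~ N) l -> \prod_(p <- l) p %| N.
Proof.
elim: l => [|p l IH] /=; first by rewrite big_nil dvd1n.
move=> /andP[pl ul] /andP[pp al] /andP[pN dl]; rewrite big_cons Gauss_dvd ?pN ?IH //.
elim: l pl al {IH ul dl} => [|q l IH]; first by rewrite big_nil coprimen1.
rewrite inE negb_or => /andP[pq pl] /andP[qp al]; rewrite big_cons coprimeMr IH //.
by rewrite prime_coprime // dvdn_prime2 // pq.
Qed.

Lemma primorial_cat a b :
  primorial (a + b) = primorial a * \prod_(p <- [seq p <- iota a.+1 b | prime p]) p.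
Proof. by rewrite /primorial /primes_upto iotaD filter_cat big_cat. Qed.

Lemma prod_primes_gt0 l : 0 < \prod_(p <- [seq p <- l | prime p]) p.
Proof. by rewrite big_filter prodn_cond_gt0 // => p /prime_gt0. Qed.

Lemma primorial_gt0 n : 0 < primorial n.
Proof. exact: prod_primes_gt0. Qed.

Lemma primorial_mono a b : a <= b -> primorial a <= primorial b.
Proof. by move=> /subnKC <-; rewrite primorial_cat leq_pmulr // prod_primes_gt0. Qed.

Lemma prod_primes_le a b : \prod_(p <- [seq p <- iota a.+1 b | prime p]) p <= (a + b) ^ b.
Proof.
elim: b => [|b IH]; first by rewrite big_nil.
rewrite -{1}(addn1 b) iotaD filter_cat big_cat /= expnSr; apply: leq_mul.
  apply: leq_trans IH _; case: b => // b.
  by rewrite leq_exp2r //; lia.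
case: ifP => _; first by rewrite big_seq1; lia.
by rewrite big_nil; lia.
Qed.

(** Split the primes at [n] and [6n]: the middle ones divide [trinom n], and the remaining range of
    five numbers is bounded trivially. *)
Lemma primorial_step n s : s <= 5 ->
  primorial (6 * n + s) <= primorial n * 432 ^ n * (6 * n + 5) ^ 5.
Proof.
move=> s5; apply: leq_trans (primorial_mono _ (6 * n + 5) _) _; first by lia.
rewrite primorial_cat leq_mul ?prod_primes_le //.
rewrite (_ : 6 * n = n + 5 * n); last by lia.
rewrite primorial_cat leq_mul //; apply: leq_trans (trinom_le n).
apply: dvdn_leq; first by rewrite /trinom muln_gt0 !bin_gt0; lia.
apply: prod_primes_dvd; first by rewrite filter_uniq ?iota_uniq.
  exact: filter_all.
apply/allP => p; rewrite mem_filter mem_iota => /andP[pp np].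
by apply: prime_dvd_trinom => //; lia.
Qed.

(** At most [y] primes are up to [y]; each of the other [c] contributes a factor above [y] to the
    primorial. *)
Lemma prime_count n y : exists2 c, size (primes_upto n) <= y + c & y ^ c <= primorial n.
Proof.
case: (leqP n y) => [ny|yn].
  exists 0; last by rewrite expn0 primorial_gt0.
  by rewrite addn0 (leq_trans _ ny) // size_filter (leq_trans (count_size _ _)) ?size_iota.
have En : n = y + (n - y) by lia.
exists (size [seq p <- iota y.+1 (n - y) | prime p]).
  rewrite {1}En /primes_upto iotaD filter_cat size_cat leq_add2r.
  by rewrite size_filter (leq_trans (count_size _ _)) ?size_iota.
rewrite {2}En primorial_cat.
apply: leq_trans (leq_pmull _ (primorial_gt0 y)).
have : all (fun p => y < p) [seq p <- iota y.+1 (n - y) | prime p].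
  by apply/allP => p; rewrite mem_filter mem_iota => /and3P[].
elim: [seq _ <- _ | _] => [|p l IH] /=; first by rewrite big_nil.
by case/andP=> yp /IH le; rewrite big_cons expnS leq_mul // ltnW.
Qed.

(** A power [p^e <= n] with [e >= 2] has [p] at most the square root of [n] and [e] at most its
    binary logarithm. *)
Lemma Ppow_le n : Ppow n <= size (primes_upto n) + Nat.sqrt n * trunc_log 2 n.
Proof.
rewrite /Ppow -size_filter.
set L := [seq p ^ e | p <- iota 1 (Nat.sqrt n), e <- iota 1 (trunc_log 2 n)].
have <- : size L = Nat.sqrt n * trunc_log 2 n by rewrite size_allpairs !size_iota.
rewrite -size_cat; apply: uniq_leq_size; first by rewrite filter_uniq ?iota_uniq.
move=> q; rewrite mem_filter mem_iota add1n ltnS => /and3P[/prime_powerP[p [e [pp e0 ->]]] _ le_n].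
rewrite mem_cat; case: e e0 le_n => [|[|e]] // _ le_n.
  by rewrite expn1 in le_n *; rewrite mem_filter pp mem_iota prime_gt0 //= add1n ltnS le_n.
apply/orP; right; apply/allpairsP; exists (p, e.+2); split=> //=.
  rewrite mem_iota prime_gt0 //= add1n ltnS.
  apply/leP/(PeanoNat.Nat.sqrt_le_square n p)/leP; apply: leq_trans le_n.
  by rewrite multE mulnn leq_exp2l // prime_gt1.
rewrite mem_iota /= add1n ltnS trunc_log_max //.
by apply: leq_trans le_n; rewrite leq_exp2r // prime_gt1.
Qed.

(* Real estimates *)
Delimit Scope R_scope with Re.

Lemma INR_leq a b : a <= b -> (INR a <= INR b)%Re.
Proof. by move=> /leP; apply: le_INR. Qed.

Lemma INR_addn a b : INR (a + b) = (INR a + INR b)%Re.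
Proof. exact: plus_INR. Qed.

Lemma INR_muln a b : INR (a * b) = (INR a * INR b)%Re.
Proof. exact: mult_INR. Qed.

Lemma INR_expn a b : INR (a ^ b) = (INR a ^ b)%Re.
Proof. by elim: b => [|b IH] //; rewrite expnS INR_muln IH. Qed.

Lemma INR_gt0 a : 0 < a -> (0 < INR a)%Re.
Proof. by move=> /ltP; apply: lt_0_INR. Qed.

Lemma ln_le_mono x y : (0 < x)%Re -> (x <= y)%Re -> (ln x <= ln y)%Re.
Proof.
move=> x0 [xy|->]; last exact: Rle_refl.
exact/Rlt_le/ln_increasing.
Qed.

Lemma ln_lt_id x : (0 < x)%Re -> (ln x < x)%Re.
Proof.
move=> x0; have := exp_ineq1_le (ln x); rewrite exp_ln //; lra.
Qed.

Lemma nat_ceil (r : R) : (0 <= r)%Re -> exists y : nat, (r <= INR y <= r + 1)%Re.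
Proof.
move=> r0; have [u1 u2] := archimed r.
have [y Ey] : exists y : nat, up r = Z.of_nat y.
  by apply: IZN; apply: le_IZR; lra.
by exists y; rewrite INR_IZR_INZ -Ey; lra.
Qed.

Lemma exp_mul_INR n x : exp (INR n * x) = (exp x ^ n)%Re.
Proof.
elim: n => [|n IH]; first by rewrite Rmult_0_l exp_0.
by rewrite S_INR Rmult_plus_distr_r Rmult_1_l exp_plus IH Rmult_comm.
Qed.

(** From [1 + x <= exp x]: [exp 0.1 >= 1.005^20 >= 1.1048], then [exp 6.1 >= 1.1048^61 >= 432]. *)
Lemma ln_432 : (ln 432 <= 6.1)%Re.
Proof.
rewrite -(ln_exp 6.1%Re); apply: ln_le_mono; first lra.
have le : (1.1048 <= exp 0.1)%Re.
  have -> : (0.1 = INR 20 * 0.005)%Re by rewrite INR_IZR_INZ /=; lra.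
  rewrite exp_mul_INR; apply: Rle_trans (pow_incr 1.005%Re _ 20 _); first by rewrite /=; lra.
  by have := exp_ineq1_le 0.005%Re; lra.
have -> : (6.1 = INR 61 * 0.1)%Re by rewrite INR_IZR_INZ /=; lra.
rewrite exp_mul_INR; apply: Rle_trans (pow_incr 1.1048%Re _ 61 _); first by rewrite /=; lra.
by lra.
Qed.

(** Chebyshev's function, the sum of [ln p] over the primes [p <= n]. *)
Definition theta n := ln (INR (primorial n)).

Lemma theta_mono a b : a <= b -> (theta a <= theta b)%Re.
Proof.
move=> ab; apply: ln_le_mono; first exact/INR_gt0/primorial_gt0.
exact/INR_leq/primorial_mono.
Qed.

Lemma theta_step n s : s <= 5 ->
  (theta (6 * n + s) <= theta n + INR n * ln 432 + 5 * ln (INR (6 * n + 5)))%Re.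
Proof.
move=> s5; have p0 := INR_gt0 _ (primorial_gt0 n).
have q0 : (0 < INR (6 * n + 5))%Re by apply: INR_gt0; lia.
have c0 : (0 < 432 ^ n)%Re by apply: pow_lt; lra.
have -> : (theta n + INR n * ln 432 + 5 * ln (INR (6 * n + 5)))%Re =
    ln (INR (primorial n * 432 ^ n * (6 * n + 5) ^ 5)).
  have E432 : INR 432 = 432%Re by rewrite INR_IZR_INZ /=; lra.
  have r0 : (0 < INR (6 * n + 5) ^ 5)%Re by apply: pow_lt.
  rewrite 2!INR_muln !INR_expn E432.
  rewrite (ln_mult _ _ (Rmult_lt_0_compat _ _ p0 c0) r0) (ln_mult _ _ p0 c0) !ln_pow //; last lra.
  by rewrite /theta [INR 5]INR_IZR_INZ /=; lra.
apply: ln_le_mono; first exact/INR_gt0/primorial_gt0.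
exact/INR_leq/primorial_step.
Qed.

(** Induction from [q = n / 6] to [n]. The slope closes up because
    [1.225 + 6.1 + 0.025 = 6 * 1.225], where [0.025 q] absorbs the logarithm once [q] exceeds a
    million; [B] covers all smaller [n]. *)
Lemma theta_le : exists2 B : R, (0 <= B)%Re &
  forall n, (theta n <= 1.225 * INR n + B)%Re.
Proof.
have [N HN] := INR_unbounded 1000000%Re.
exists (theta (6 * N + 6)).
  rewrite -ln_1; apply: ln_le_mono; first lra.
  exact/(INR_leq 1)/primorial_gt0.
move=> n; have [M] := ubnP n; elim: M n => // M IH n ltn.
have n0 := pos_INR n.
case: (leqP n (6 * N + 6)) => [/theta_mono|lt_n]; first lra.
have En : n = 6 * (n %/ 6) + n %% 6 by rewrite {1}(divn_eq n 6) mulnC.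
move: (n %/ 6) (n %% 6) (ltn_pmod n (isT : 0 < 6)) En => q s s6 En.
have qN : N < q by lia.
have IHq : (theta q <= 1.225 * INR q + theta (6 * N + 6))%Re by apply: IH; lia.
have := theta_step q s s6; rewrite -En.
have q1 : (1000000 < INR q)%Re by apply: Rlt_le_trans HN _; apply: INR_leq; lia.
have nq : (6 * INR q <= INR n)%Re.
  have -> : (6 * INR q)%Re = INR (6 * q) by rewrite INR_muln /=; lra.
  by apply: INR_leq; lia.
have E5 : INR (6 * q + 5) = (6 * INR q + 5)%Re by rewrite INR_addn INR_muln /=; lra.
have x0 : (0 < 6 * INR q + 5)%Re by lra.
(* [ln x = 2 ln (sqrt x) < 2 sqrt x] *)
have l1 : (ln (6 * INR q + 5) <= 2 * sqrt (6 * INR q + 5))%Re.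
  have s0 : (0 < sqrt (6 * INR q + 5))%Re by apply: sqrt_lt_R0.
  rewrite -{1}(sqrt_sqrt (6 * INR q + 5)); last lra.
  rewrite ln_mult //; have := ln_lt_id _ s0; lra.
have l2 : (sqrt (6 * INR q + 5) <= 0.0025 * INR q)%Re.
  rewrite -(sqrt_Rsqr (0.0025 * INR q)); last lra.
  by apply: sqrt_le_1_alt; rewrite /Rsqr; nra.
have l3 : (INR q * ln 432 <= INR q * 6.1)%Re.
  by apply: Rmult_le_compat_l; [lra | exact: ln_432].
by rewrite E5; lra.
Qed.

(** Bounding [exp (0.02 t)] below by [(1 + 0.01 t)^2] gives the threshold, as
    [2000000 = 1 / (0.005 * 0.01^2)]. *)
Lemma exp_eventually (K t : R) : (0 < K)%Re -> (2000000 * K <= t)%Re ->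
  (K * exp (0.98 * t) * t < 0.005 * exp t)%Re.
Proof.
move=> K0 Kt; have t0 : (0 < t)%Re by lra.
have e0 := exp_pos (0.98 * t).
have -> : exp t = (exp (0.98 * t) * (exp (0.01 * t) * exp (0.01 * t)))%Re.
  by rewrite -!exp_plus; congr exp; lra.
have l := exp_ineq1_le (0.01 * t).
have : (K * t < 0.005 * (exp (0.01 * t) * exp (0.01 * t)))%Re.
  apply: Rlt_le_trans (_ : (0.005 * ((1 + 0.01 * t) * (1 + 0.01 * t)) <= _)%Re); first nra.
  apply: Rmult_le_compat_l; first lra.
  by apply: Rmult_le_compat; lra.
by move=> /(Rmult_lt_compat_l _ _ _ e0); lra.
Qed.

(** Counting primes with threshold about [n^0.98] gives the main term [1.225 / 0.98 = 1.25] times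
    [n / ln n]; the threshold and the constants cost less than [0.005] more. *)
Lemma Ppow_asymp : exists m0 : nat, forall n, m0 <= n ->
  (INR (2 + Ppow n) < 2 * sqrt (INR n) * ln (INR n) + 1.25506 * INR n / ln (INR n))%Re.
Proof.
have [B B0 HB] := theta_le.
pose K := (4 + 2 * B)%Re; have K0 : (4 <= K)%Re by rewrite /K; lra.
have [m0 Hm0] := INR_unbounded (exp (2000000 * K)).
exists m0 => n /INR_leq m0n.
pose x := INR n; pose t := ln x.
have xe : (exp (2000000 * K) < x)%Re by rewrite /x; lra.
have x0 : (0 < x)%Re by have := exp_pos (2000000 * K); lra.
have n0 : 0 < n by rewrite lt0n; apply/eqP => E; move: x0; rewrite /x E /=; lra.
have tK : (2000000 * K <= t)%Re.
  by rewrite -(ln_exp (2000000 * K)); apply: ln_le_mono; [exact: exp_pos | lra].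
have Ex : exp t = x by rewrite /t exp_ln.
have e1 : (1 <= exp (0.98 * t))%Re.
  by have := exp_ineq1_le (0.98 * t); lra.
have [y [y1 y2]] := nat_ceil (exp (0.98 * t)) (Rle_trans _ _ _ Rle_0_1 e1).
have [c cL cP] := prime_count n y.
have cb : (INR c * (0.98 * t) <= 1.225 * x + B)%Re.
  apply: Rle_trans (HB n); rewrite /theta.
  apply: Rle_trans (_ : (ln (INR (y ^ c)) <= _)%Re); last first.
    apply: ln_le_mono; last exact: INR_leq.
    by rewrite INR_expn; apply: pow_lt; lra.
  rewrite INR_expn ln_pow; last lra.
  apply: Rmult_le_compat_l; first exact: pos_INR.
  by rewrite -(ln_exp (0.98 * t)); apply: ln_le_mono; [exact: exp_pos | lra].
have t0 : (0 < t)%Re by lra.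
have xtt : (x / t * t = x)%Re by field; lra.
have cb' : (INR c <= 1.25 * (x / t) + 2 * B)%Re.
  apply: (Rmult_le_reg_r (0.98 * t)); first lra.
  have : (B * 1 <= B * t)%Re by apply: Rmult_le_compat_l; lra.
  by move: (x / t)%Re xtt => u xtt; lra.
have sb : (INR (Nat.sqrt n) <= sqrt x)%Re.
  rewrite -(sqrt_Rsqr (INR (Nat.sqrt n))); last exact: pos_INR.
  apply: sqrt_le_1_alt; rewrite /Rsqr -mult_INR; apply: le_INR.
  by have [] := PeanoNat.Nat.sqrt_spec n (PeanoNat.Nat.le_0_l n).
(* This uses [ln 2 > 1/2]. *)
have lb : (INR (trunc_log 2 n) <= 2 * t)%Re.
  have : (ln (INR (2 ^ trunc_log 2 n)) <= t)%Re.
    apply: ln_le_mono; first by apply: INR_gt0; rewrite expn_gt0.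
    by apply: INR_leq; apply: trunc_logP.
  rewrite INR_expn ln_pow; last by rewrite /=; lra.
  have := ln_lt_2; have := pos_INR (trunc_log 2 n); rewrite (_ : INR 2 = 2%Re) //; nra.
have slb : (INR (Nat.sqrt n) * INR (trunc_log 2 n) <= sqrt x * (2 * t))%Re.
  by apply: Rmult_le_compat => //; exact: pos_INR.
have Pb : (INR (2 + Ppow n) <= 2 + INR y + INR c + INR (Nat.sqrt n) * INR (trunc_log 2 n))%Re.
  rewrite -INR_muln -[2%Re]/(INR 2) -!INR_addn; apply: INR_leq.
  by have := Ppow_le n; lia.
have := exp_eventually K t (Rlt_le_trans _ _ _ (_ : 0 < 4)%Re K0) tK.
rewrite Ex => /(_ ltac:(lra)) big.
have big' : (K * exp (0.98 * t) < 0.005 * (x / t))%Re.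
  apply: (Rmult_lt_reg_r t); first lra.
  by rewrite (Rmult_assoc 0.005) xtt.
have xt : (0 < x / t)%Re by apply: Rdiv_lt_0_compat; lra.
have Ke : (3 + 2 * B + exp (0.98 * t) <= K * exp (0.98 * t))%Re by rewrite /K; nra.
rewrite -/x -/t; have -> : (1.25506 * x / t = 1.25506 * (x / t))%Re by rewrite /Rdiv Rmult_assoc.
by lra.
Qed.

Theorem mainTheorem12 :
  (* TD = PBTD = 0 for NCPi^z_{∞,1}, every z in N ∪ {∞} (z >= 1) *)
  (forall z : option nat, z <> Some 0 ->
     TD_eq z (NCm z 1) 0 /\ PBTD_eq z (NCm z 1) 0) /\
  (* (i) z = 1: TD and PBTD are Theta(m) *)
  ((exists c : nat, 0 < c /\ exists m0 : nat, forall m : nat, 2 <= m -> m0 <= m ->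
       TD_le (Some 1) (NCm (Some 1) m) (c * m) /\
       exists d, m <= c * d /\ TD_ge (Some 1) (NCm (Some 1) m) d) /\
   (exists c : nat, 0 < c /\ exists m0 : nat, forall m : nat, 2 <= m -> m0 <= m ->
       PBTD_le (Some 1) (NCm (Some 1) m) (c * m) /\
       exists d, m <= c * d /\ PBTD_ge (Some 1) (NCm (Some 1) m) d)) /\
  (* (ii) z >= 2 (including z = ∞) *)
  (forall z : option nat, z = None \/ (exists k, 2 <= k /\ z = Some k) ->
     (forall m : nat, 2 <= m ->
        [/\ TD_ge z (NCm z m) (\max_(n < m.+1) omega n),
            TD_le z (NCm z m) (2 + Ppow (m - 1)),
            PBTD_eq z (NCm z m) 1 &
            PBTD_eq z (NC z) 1]) /\
     (exists C : R, exists m0 : nat, forall m : nat, 2 <= m -> m0 <= m ->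
        exists d : nat, TD_le z (NCm z m) d /\
          Rlt (INR d)
              (Rplus (Rmult (Rmult C (sqrt (INR (m - 1)))) (ln (INR (m - 1))))
                     (Rdiv (Rmult (Rdiv (IZR 125506) (IZR 100000)) (INR (m - 1)))
                           (ln (INR (m - 1))))))).

Proof.
split; first by move=> z _; apply: TD_one.
split; [split|].
(* With [k] the quotient of [m - 1] by 4, [4k+1 <= m <= 4k+4], and [4k+4 <= 8k] because [m >= 5]
   makes [k] positive. *)
- exists 8; split=> //; exists 5 => m m2 m5; split.
    move=> p /TD_unary_le[T [sT HT]]; exists T; split=> //; lia.
  exists (m.-1 %/ 4); split; first by lia.
  by apply/PBTD_TD_ge/PBTD_unary_ge; lia.
- exists 8; split=> //; exists 5 => m m2 m5; split.
    apply: TD_PBTD_le => p /TD_unary_le[T [sT HT]]; exists T; split=> //; lia.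
  exists (m.-1 %/ 4); split; first by lia.
  by apply: PBTD_unary_ge; lia.
move=> z zE.
have z2 : two_letters z by case: zE => [->|[[|[|k]] [k2 ->]]].
have z0 : inSigma z 0 by case/andP: z2.
split=> [m m2|].
  split; [exact: TD_lower | exact: TD_upper | |]; split.
  - by apply: PBTD_upper => // p [].
  - exact: (PBTD_lower_NC z m).
  - exact: PBTD_upper.
  - by apply: (PBTD_lower_NC z m) => // p [].
have [m0 H] := Ppow_asymp; exists 2%Re, m0.+1 => m m2 mm; exists (2 + Ppow (m - 1)).
split; first exact: TD_upper.
have := H (m - 1); rewrite (_ : m0 <= m - 1); last by lia.
by move=> /(_ isT); lra.
Qed.
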